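(* For every integer $k\ge2$, the Riemann zeta value $\zeta(k)$ lies in the $\mathbb{Q}$-linear span of $S'_{k,1}$.
   Context: $A(\theta)=\log|2\sin(\theta/2)|$; for $k_u\ge2$, $\mathrm{SLs}(k_1,\dots,k_n)=\int_0^{\pi/3}\int_0^{\theta_n}\cdots\int_0^{\theta_2}\prod_{u=1}^n(\theta_u-\pi/3)^{k_u-2}A(\theta_u)\,d\theta_1\cdots d\theta_n$, with $\mathrm{SLs}(\emptyset)=1$. For $k,d\in\mathbb{Z}_{\ge0}$, $S'_{k,d}=\{\pi^{2m}\mathrm{SLs}(k_1,\dots,k_n): 2m+k_1+\dots+k_n=k,\ m\ge0,\ 0\le n\le d,\ \text{each }k_i\ge3\text{ odd}\}$. *)

(* Defs.v *)
From HB Require Import structures.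
From mathcomp Require Import all_boot all_order all_algebra.
From mathcomp Require Import all_classical all_reals all_analysis.
Set Implicit Arguments. Unset Strict Implicit. Unset Printing Implicit Defensive.
Import Order.TTheory GRing.Theory Num.Theory numFieldNormedType.Exports.
Local Open Scope classical_set_scope.
Local Open Scope ring_scope.

Section Defs.
Variable R : realType.

Definition Afun (t : R) : R := ln `|2 * sin (t / 2)|.

Definition SLs_integrand (k : nat) (t : R) : R :=
  (t - pi / 3) ^+ (k - 2) * Afun t.

(* Lebesgue integral over [0, t] (the integrand has an integrable log
   singularity at 0, so a Lebesgue integral is used). *)
Definition Int0 (t : R) (f : R -> R) : R :=
  Rintegral (@lebesgue_measure R) `[0, t] f.

(* SLs_aux [:: k_n; ...; k_1] t =
   int_{0<theta_1<...<theta_n<t} prod_u (theta_u - pi/3)^(k_u-2) A(theta_u) *)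
Fixpoint SLs_aux (ks : seq nat) (t : R) : R :=
  match ks with
  | [::] => 1
  | k :: ks' => Int0 t (fun th => SLs_integrand k th * SLs_aux ks' th)
  end.

(* SLs(k_1, ..., k_n), with theta_1 < ... < theta_n < pi/3, k_u attached to theta_u *)
Definition SLs (ks : seq nat) : R := SLs_aux (rev ks) (pi / 3).

Definition Sprime (k d : nat) : set R :=
  [set x | exists (m : nat) (ks : seq nat),
      [/\ (2 * m + sumn ks)%N = k, (size ks <= d)%N,
          all (fun j => (3 <= j)%N && odd j) ks &
          x = pi ^+ (2 * m) * SLs ks]].

Definition in_Qspan (S : set R) (x : R) : Prop :=
  exists (l : seq (rat * R)),
    (forall p, p \in l -> S p.2) /\
    x = \sum_(p <- l) ratr p.1 * p.2.

Definition zeta (k : nat) : R :=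
  limn (series (fun n : nat => (((n.+1)%:R : R) ^+ k)^-1)).

End Defs.

(* Main.v *)
Require Import Defs.
From HB Require Import structures.
From mathcomp Require Import all_boot all_order all_algebra.
From mathcomp Require Import all_classical all_reals all_analysis.
From mathcomp Require Import ring lra zify.
Set Implicit Arguments. Unset Strict Implicit. Unset Printing Implicit Defensive.
Import Order.TTheory GRing.Theory Num.Theory.
Import numFieldNormedType.Exports.
Local Open Scope classical_set_scope.
Local Open Scope ring_scope.

(** Euler's formula for even weights and a triangular system for odd weights
    both come from the Dirichlet kernel. Put
    [F t = (t - a) ^+ (2 m) - a ^+ (2 m)]; it vanishes at [0], so
    [F t / (2 sin (t / 2))] has bounded derivative on [0, pi] and oscillating
    integrals of it are [O(1 / N)].

    For [a = pi] this gives [\sum_n \int_0^pi F cos (n t) = - 1/2 \int_0^pi F],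
    which expresses [zeta (2 m)] through [pi ^ (2 m)] and lower even zeta values.

    For [a = pi / 3], [Afun] vanishes at [a], and integrating
    [(t - a) ^+ (2 m - 1) * Afun t] by parts against
    [Afun' t = cot (t / 2) / 2 ~ \sum_n sin (n t)] gives
    [2 m SLs (2 m + 1) = - \sum_n \int_0^a F sin (n t)]. Repeated integration by
    parts turns the right-hand side into a combination of
    [pi ^ (2 i) zeta (2 m + 1 - 2 i)], because [\sum_n cos (n pi / 3) / n ^ s] is a
    rational multiple of [zeta s] (and [0] for [s = 1]); the coefficient of
    [zeta (2 m + 1)] is nonzero. *)

(** * Calculus of pointwise derivatives *)

Section PointwiseDerivatives.
Context {R : realType}.
Implicit Types (f g : R -> R) (x a b c : R).

(* Unlike [is_derive], this is not a typeclass: resolution would otherwise fill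
   in derivatives in scaled form, which [ring] and [field] do not read. *)
Definition has_derive f x a := is_derive x 1 f a.

Lemma has_derive_is_derive f x a b :
  has_derive f x a -> a = b -> is_derive x 1 f b.
Proof. by move=> ? <-. Qed.

Lemma has_deriveD f g x a b : has_derive f x a -> has_derive g x b ->
  has_derive (fun t => f t + g t) x (a + b).
Proof. exact: is_deriveD. Qed.

Lemma has_deriveN f x a : has_derive f x a ->
  has_derive (fun t => - f t) x (- a).
Proof. exact: is_deriveN. Qed.

Lemma has_deriveM f g x a b : has_derive f x a -> has_derive g x b ->
  has_derive (fun t => f t * g t) x (f x * b + g x * a).
Proof. exact: is_deriveM. Qed.

Lemma has_deriveX f n x a : has_derive f x a ->
  has_derive (fun t => f t ^+ n) x (n%:R * f x ^+ n.-1 * a).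
Proof.
rewrite (_ : (fun _ => _) = f ^+ n); first exact: is_deriveX.
by apply/funext => t; rewrite exprfctE.
Qed.

Lemma has_deriveV f x a : f x != 0 -> has_derive f x a ->
  has_derive (fun t => (f t)^-1) x (- (f x) ^- 2 * a).
Proof. exact: is_deriveV. Qed.

Lemma has_derive_sin f x a : has_derive f x a ->
  has_derive (fun t => sin (f t)) x (cos (f x) * a).
Proof. exact: is_derive1_comp. Qed.

Lemma has_derive_cos f x a : has_derive f x a ->
  has_derive (fun t => cos (f t)) x (- sin (f x) * a).
Proof. exact: is_derive1_comp. Qed.

Lemma has_derive_ln f x a : 0 < f x -> has_derive f x a ->
  has_derive (fun t => ln (f t)) x ((f x)^-1 * a).
Proof. by move=> /is_derive1_ln; exact: is_derive1_comp. Qed.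

Lemma has_derive_horner (p : {poly R}) x :
  has_derive (fun t => p.[t]) x p^`().[x].
Proof. exact: is_derive_poly. Qed.

Lemma has_derive_cst c x : has_derive (fun=> c) x 0.
Proof. exact: is_derive_cst. Qed.

Lemma has_derive_id x : has_derive (fun t => t) x 1.
Proof. exact: is_derive_id. Qed.

Lemma has_derive_sum (F : nat -> R -> R) (dF : nat -> R) n x :
  (forall i, has_derive (F i) x (dF i)) ->
  has_derive (fun t => \sum_(0 <= i < n) F i t) x (\sum_(0 <= i < n) dF i).
Proof.
move=> dFi; elim: n => [|n IHn].
  rewrite big_nil; under eq_fun do rewrite big_nil; exact: has_derive_cst.
rewrite big_nat_recr//=; under eq_fun do rewrite big_nat_recr//=.
exact: has_deriveD.
Qed.

Lemma is_derive_continuous f x a : is_derive x 1 f a -> {for x, continuous f}.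
Proof.
by move=> fx; apply/differentiable_continuous/derivable1_diffP.
Qed.

End PointwiseDerivatives.

(** Differentiation directed by syntax. Functions without a rule are handled by an [is_derive]
    hypothesis in the context, and the side conditions of inverse and logarithm are left as goals.
    The [GRing.mul ?c] case catches the eta-contracted form of [fun t => c * t]. *)
Ltac differentiate :=
  repeat (cbv beta; lazymatch goal with
  | H : is_derive ?x 1 ?f _ |- has_derive ?f ?x _ => exact: H
  | |- has_derive (fun _ => ?c) _ _ => exact: has_derive_cst
  | |- has_derive (fun t => t) _ _ => exact: has_derive_id
  | |- has_derive (fun t => _ + _) _ _ => apply: has_deriveD
  | |- has_derive (fun t => - _) _ _ => apply: has_deriveN
  | |- has_derive (fun t => _ * _) _ _ => apply: has_deriveM
  | |- has_derive (fun t => _ ^+ _) _ _ => apply: has_deriveX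
  | |- has_derive (fun t => _ ^-1) _ _ => apply: has_deriveV
  | |- has_derive (fun t => sin _) _ _ => apply: has_derive_sin
  | |- has_derive (fun t => cos _) _ _ => apply: has_derive_cos
  | |- has_derive (fun t => ln _) _ _ => apply: has_derive_ln
  | |- has_derive (horner _) _ _ => exact: has_derive_horner
  | |- has_derive (GRing.mul ?c) _ _ =>
      apply: (has_deriveM (f := fun=> c) (g := fun t => t))
  end).

Ltac derive_as := apply: has_derive_is_derive; [differentiate|cbv beta].

(** * Decay of integrals against an oscillating cosine *)

Section OscillatoryBound.
Context {R : realType}.
Implicit Types (t x a e M : R).

Lemma within_itv_continuous (f : R -> R) a b :
  (forall t, a <= t <= b -> {for t, continuous f}) ->
  {within `[a, b], continuous f}.
Proof.
move=> cf; apply: continuous_in_subspaceT => t.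
by rewrite inE /= in_itv/=; exact: cf.
Qed.

(** By duplication and the mean value theorem, [sin x = 2 sin (x / 2) cos (x / 2) = x cos c cos (x /
    2)] with [c] in [0, x / 2]. Both cosines are at least 1/2 because
    [2 cos t ^ 2 - 1 = cos (2 t) >= 0] on [0, pi / 4]. *)
Lemma sin_ge_quarter x : 0 <= x <= pi / 2 -> x / 4 <= sin x.
Proof.
move=> /andP[x0 xpi]; have pi0 := @pi_gt0 R.
have cos_ge t : 0 <= t <= pi / 4 -> 2^-1 <= cos t.
  move=> /andP[t0 tpi].
  have c0 : 0 <= cos t by apply: cos_ge0_pihalf; lra.
  have : 0 <= cos (t *+ 2) by apply: cos_ge0_pihalf; lra.
  rewrite cos_mulr2n; nra.
have [||c] := @MVT_segment R sin cos 0 (x / 2) _ (fun t _ => is_derive_sin t).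
- lra.
- by apply: within_itv_continuous => t _; exact: continuous_sin.
rewrite in_itv/= sin0 !subr0 => /andP[c0 cx] sE.
rewrite {2}(_ : x = (x / 2) *+ 2); last by lra.
rewrite sin_mulr2n sE.
have := cos_ge c; have := cos_ge (x / 2).
move=> /(_ ltac:(lra)) h1 /(_ ltac:(lra)) h2.
have : 4^-1 <= cos (x / 2) * cos c by nra.
nra.
Qed.

(** Splitting [F t = t * p.[t]] isolates in this factor the removable singularity of
    [F t / (2 sin (t / 2))] at 0. *)
Definition half_angle_ratio t : R := t / (2 * sin (t / 2)).

Definition half_angle_ratio' t : R :=
  (2 * sin (t / 2) - t * cos (t / 2)) / (2 * sin (t / 2)) ^+ 2.

Lemma sin_half_gt0 t : 0 < t <= pi -> 0 < sin (t / 2).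
Proof. by move=> ?; apply: sin_gt0_pi; have := @pi_gt0 R; lra. Qed.

Lemma is_derive_half_angle_ratio t : 0 < t <= pi ->
  is_derive t 1 half_angle_ratio (half_angle_ratio' t).
Proof.
move=> tpi; have s0 := sin_half_gt0 tpi.
have sn0 : 2 * sin (t / 2) != 0 by rewrite mulf_neq0 ?gt_eqF.
rewrite /half_angle_ratio; derive_as; first by [].
rewrite /half_angle_ratio'; field.
by rewrite gt_eqF.
Qed.

Lemma half_angle_ratio_bound t : 0 < t <= pi -> `|half_angle_ratio t| <= 4.
Proof.
move=> tpi; have s0 := sin_half_gt0 tpi.
have := @sin_ge_quarter (t / 2) ltac:(lra) => sq.
rewrite /half_angle_ratio ger0_norm; first by rewrite ler_pdivrMr; lra.
by rewrite divr_ge0//; lra.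
Qed.

(** The numerator [k] vanishes at 0 and has derivative [x / 2 * sin (x / 2)], so it is at most
    [t ^ 2 / 2]. The denominator is at least [(t / 4) ^ 2]. *)
Lemma half_angle_ratio'_bound t : 0 < t <= pi -> `|half_angle_ratio' t| <= 8.
Proof.
move=> tpi; have s0 := sin_half_gt0 tpi.
have := @sin_ge_quarter (t / 2) ltac:(lra) => sq.
pose k x : R := 2 * sin (x / 2) - x * cos (x / 2).
have dk x : is_derive x 1 k (x / 2 * sin (x / 2)).
  by rewrite /k; derive_as; field.
have [||c] := @MVT_segment R k _ 0 t _ (fun x _ => dk x).
- lra.
- by apply: within_itv_continuous => x _; exact: is_derive_continuous (dk x).
rewrite in_itv/= {2}/k mul0r sin0 mulr0 mul0r !subr0 => /andP[c0 ct] kt.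
rewrite /half_angle_ratio' -/(k t) normrM normfV ler_pdivrMr; last first.
  by rewrite normr_gt0 expf_neq0// mulf_neq0 ?gt_eqF.
have sc1 := @sin_le1 R (c / 2); have sc0 : 0 <= sin (c / 2).
  by apply: sin_ge0_pi; lra.
rewrite kt !ger0_norm; last first.
- by rewrite !mulr_ge0//; lra.
- by rewrite exprn_ge0//; lra.
have : c / 2 * sin (c / 2) * t <= t / 2 * 1 * t.
  by rewrite ler_wpM2r ?ler_pM; lra.
by move=> /le_trans; apply; nra.
Qed.

Lemma horner_bounded (p : {poly R}) b :
  exists2 K : R, 0 <= K & forall t, 0 <= t <= b -> `|p.[t]| <= K.
Proof.
exists (\sum_(i < size p) `|p`_i| * `|b| ^+ i).
  by apply: sumr_ge0 => i _; rewrite mulr_ge0.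
move=> t /andP[t0 tb]; rewrite horner_coef (le_trans (ler_norm_sum _ _ _))//.
apply: ler_sum => i _; rewrite normrM normrX ler_wpM2l// lerXn2r ?nnegrE//.
by rewrite !ger0_norm// (le_trans t0).
Qed.

(* Integration by parts against the oscillating factor, with the mean value
   inequality in place of the integral of the remainder. *)
Lemma oscillatory_bound (p : {poly R}) :
  exists2 K : R, 0 <= K & forall M phi e a (U : R -> R),
  0 < M -> 0 < e -> e < a -> a <= pi ->
  {within `[e, a], continuous U} ->
  (forall t, e < t < a ->
    is_derive t 1 U (t * p.[t] / (2 * sin (t / 2)) * cos (M * t + phi))) ->
  `|U a - U e| <= K / M.
Proof.
have [K0 K00 K0P] := horner_bounded p pi.
have [K1 K10 K1P] := horner_bounded p^`() pi.
(* The first term bounds [g'] times the length of the interval, the second bounds the two boundary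
   terms, each at most [4 * K0 / M]. *)
exists ((8 * K0 + 4 * K1) * pi + 8 * K0).
  have := @pi_ge0 R; nra.
move=> M phi e a U M0 e0 ea api cU dU; have pi0 := @pi_gt0 R.
pose g t := half_angle_ratio t * p.[t].
pose g' t := half_angle_ratio t * p^`().[t] + p.[t] * half_angle_ratio' t.
have dg t : 0 < t <= pi -> is_derive t 1 g (g' t).
  move=> tpi; have ? := is_derive_half_angle_ratio tpi.
  by rewrite /g; derive_as.
have gb t : 0 < t <= pi -> `|g t| <= 4 * K0.
  move=> tpi; rewrite normrM ler_pM// ?half_angle_ratio_bound//.
  by apply: K0P; lra.
have g'b t : 0 < t <= pi -> `|g' t| <= 8 * K0 + 4 * K1.
  move=> tpi; rewrite (le_trans (ler_normD _ _))//.
  rewrite (normrM (half_angle_ratio t)) (normrM p.[t]) [leRHS]addrC.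
  apply: lerD; last rewrite (mulrC 8); apply: ler_pM => //.
  - exact: half_angle_ratio_bound.
  - by apply: K1P; lra.
  - by apply: K0P; lra.
  - exact: half_angle_ratio'_bound.
(* Removing the boundary term of the integration by parts leaves a function whose derivative carries
   the factor [1 / M]. *)
pose V t := U t - g t * (sin (M * t + phi) / M).
have dB t : 0 < t <= pi -> is_derive t 1 (fun t => g t * (sin (M * t + phi) / M))
    (g t * cos (M * t + phi) + g' t * sin (M * t + phi) / M).
  move=> tpi; have ? := dg _ tpi; derive_as.
  by field; rewrite gt_eqF.
have dV t : t \in `]e, a[ -> is_derive t 1 V (- (g' t * sin (M * t + phi) / M)).
  rewrite in_itv/= => tea.
  have ? := dU t tea; have ? := dB t ltac:(lra).
  rewrite /V; derive_as.
  by rewrite /g /half_angle_ratio; ring.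
have cV : {within `[e, a], continuous V}.
  move=> t; apply: cvgB; first exact: cU.
  apply: (within_itv_continuous (f := fun t => _)) => {}t tea.
  by apply: is_derive_continuous (dB t _); lra.
have [c] := MVT ea dV cV.
rewrite in_itv/= => cea VE.
have -> : U a - U e = V a - V e + g a * (sin (M * a + phi) / M)
    - g e * (sin (M * e + phi) / M).
  by rewrite /V; ring.
have gsb t : 0 < t <= pi -> `|g t * (sin (M * t + phi) / M)| <= 4 * K0 / M.
  move=> tpi; rewrite mulrA normrM normfV (gtr0_norm M0) ler_pM2r ?invr_gt0//.
  by rewrite normrM -[leRHS]mulr1; apply: ler_pM => //;
    [exact: gb|exact: sin_max].
have Vb : `|V a - V e| <= (8 * K0 + 4 * K1) * pi / M.
  rewrite VE normrM normrN !normrM normfV (gtr0_norm M0) mulrAC.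
  rewrite ler_pM2r ?invr_gt0//; apply: ler_pM => //.
    by rewrite -[leRHS]mulr1; apply: ler_pM => //;
      [apply: g'b; lra|exact: sin_max].
  by rewrite gtr0_norm; lra.
have := gsb a; have := gsb e.
move=> /(_ ltac:(lra)) gse /(_ ltac:(lra)) gsa.
rewrite (le_trans (ler_normB _ _))//.
apply: (le_trans (lerD (ler_normD _ _) (lexx _))).
rewrite [X in _ <= X](_ : _ = (8 * K0 + 4 * K1) * pi / M + 4 * K0 / M + 4 * K0 / M).
  by rewrite !lerD.
by ring.
Qed.

End OscillatoryBound.

(** * Closed forms of the sine and cosine kernels *)

Section DirichletKernels.
Context {R : realType}.
Implicit Types t : R.

(** Telescoping, since [2 sin (t / 2) sin (n t) = cos ((n - 1/2) t) - cos ((n + 1/2) t)]. The form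
    without division also holds at zeros of [sin (t / 2)]. *)
Lemma sum_sin_dirichlet t N :
  2 * sin (t / 2) * (\sum_(0 <= i < N) sin (i.+1%:R * t)) =
  cos (t / 2) - cos ((N%:R + 2^-1) * t).
Proof.
elim: N => [|N IHN].
  by rewrite big_nil add0r mulr0 (mulrC 2^-1) subrr.
rewrite big_nat_recr//= mulrDr IHN -[N.+1%:R]natr1.
have -> : (N%:R + 1 + 2^-1) * t = (N%:R + 1) * t + t / 2 by ring.
have -> : (N%:R + 2^-1) * t = (N%:R + 1) * t - t / 2 by field.
by rewrite cosB cosD; ring.
Qed.

Lemma sum_cos_dirichlet t N :
  2 * sin (t / 2) * (2^-1 + \sum_(0 <= i < N) cos (i.+1%:R * t)) =
  sin ((N%:R + 2^-1) * t).
Proof.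
elim: N => [|N IHN].
  by rewrite big_nil add0r addr0 (mulrC 2^-1); field.
rewrite big_nat_recr//= addrA mulrDr IHN -[N.+1%:R]natr1.
have -> : (N%:R + 1 + 2^-1) * t = (N%:R + 1) * t + t / 2 by ring.
have -> : (N%:R + 2^-1) * t = (N%:R + 1) * t - t / 2 by field.
by rewrite sinB sinD; ring.
Qed.

End DirichletKernels.

(** * Trigonometric moments of even powers, and the sum of the cosine moments *)

Section Moments.
Context {R : realType}.
Implicit Types (a c t : R) (m : nat).

(** Antiderivative of [(t - a) ^+ m.*2 * sin (c * t)]. Each recursive step is two integrations by
    parts, which lower the exponent by 2. *)
Fixpoint sin_primitive a c m t : R :=
  if m is m'.+1 then
    - (t - a) ^+ m'.*2.+2 * cos (c * t) / c +
    m'.*2.+2%:R / c * ((t - a) ^+ m'.*2.+1 * sin (c * t) / c -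
                       m'.*2.+1%:R / c * sin_primitive a c m' t)
  else - cos (c * t) / c.

Fixpoint cos_primitive a c m t : R :=
  if m is m'.+1 then
    (t - a) ^+ m'.*2.+2 * sin (c * t) / c +
    m'.*2.+2%:R / c * ((t - a) ^+ m'.*2.+1 * cos (c * t) / c -
                       m'.*2.+1%:R / c * cos_primitive a c m' t)
  else sin (c * t) / c.

Lemma is_derive_sin_primitive a c m t : c != 0 ->
  is_derive t 1 (sin_primitive a c m) ((t - a) ^+ m.*2 * sin (c * t)).
Proof.
move=> c0; elim: m => [|m IHm] /=.
  by derive_as; rewrite expr0; field.
by derive_as; rewrite /= doubleS !exprS; field.
Qed.

Lemma is_derive_cos_primitive a c m t : c != 0 ->
  is_derive t 1 (cos_primitive a c m) ((t - a) ^+ m.*2 * cos (c * t)).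
Proof.
move=> c0; elim: m => [|m IHm] /=.
  by derive_as; rewrite expr0; field.
by derive_as; rewrite /= doubleS !exprS; field.
Qed.

(* The integral of [(t - a) ^+ m.*2 * sin (c * t)] over [0, a]. *)
Fixpoint sin_moment a c m : R :=
  if m is m'.+1 then
    a ^+ m'.*2.+2 / c -
    m'.*2.+2%:R * m'.*2.+1%:R * (sin_moment a c m' / c ^+ 2)
  else (1 - cos (c * a)) / c.

(* The integral of [(t - pi) ^+ m.*2 * cos (c * t)] over [0, pi], for integral
   [c]. *)
Fixpoint cos_moment c m : R :=
  if m is m'.+1 then
    m'.*2.+2%:R * pi ^+ m'.*2.+1 / c ^+ 2 -
    m'.*2.+2%:R * m'.*2.+1%:R * (cos_moment c m' / c ^+ 2)
  else 0.

Lemma sin_primitive_moment a c m : c != 0 ->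
  sin_primitive a c m a - sin_primitive a c m 0 = sin_moment a c m.
Proof.
move=> c0; elim: m => [|m IHm] /=; first by rewrite mulr0 cos0; field.
rewrite -IHm subrr sub0r mulr0 sin0 cos0 -[_.*2.+2]/(m.+1.*2) -mul2n.
rewrite (exprM (- a)) sqrrN -exprM mul2n !exprS.
by field.
Qed.

Lemma sin_nat_pi n : sin (n%:R * pi) = 0 :> R.
Proof.
elim: n => [|n IHn]; first by rewrite mul0r sin0.
by rewrite -[n.+1%:R]natr1 mulrDl mul1r sinDpi IHn oppr0.
Qed.

Lemma cos_primitive_moment n m :
  cos_primitive pi n.+1%:R m pi - cos_primitive pi n.+1%:R m 0 =
  cos_moment n.+1%:R m.
Proof.
have c0 : n.+1%:R != 0 :> R by rewrite pnatr_eq0.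
elim: m => [|m IHm] /=; first by rewrite mulr0 sin0 sin_nat_pi; field.
rewrite -IHm subrr sub0r mulr0 sin0 cos0 sin_nat_pi.
rewrite [(- pi) ^+ m.*2.+1]exprS -mul2n (exprM (- pi)) sqrrN -exprM mul2n !exprS.
by field.
Qed.

(** The exponent is even, so the right-hand side vanishes at 0. This supplies the polynomial that
    [oscillatory_bound] takes. *)
Lemma even_power_quotient a m : exists p : {poly R},
  forall t, t * p.[t] = (t - a) ^+ m.*2 - a ^+ m.*2.
Proof.
have /factor_theorem[p pE] :
    root (('X - a%:P) ^+ m.*2 - (a ^+ m.*2)%:P) 0.
  by rewrite /root !hornerE -mul2n exprM sqrrN -exprM subrr.
exists p => t; move: (congr1 (fun q => q.[t]) pE).
by rewrite !hornerE subr0 mulrC => ->.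
Qed.

Lemma ler_dist_right_cvg (U : R -> R) a c (l B : R) : 0 < a ->
  U t @[t --> 0^'+] --> l ->
  (forall t, 0 < t < a -> `|c - U t| <= B) -> `|c - l| <= B.
Proof.
move=> a0 Ul UB.
have cU : `|c - U t| @[t --> 0^'+] --> `|c - l|.
  by apply: cvg_norm; apply: cvgB => //; exact: cvg_cst.
apply: (cvgr_to_le cU); near=> t; apply: UB; apply/andP; split; first by near: t; exact: nbhs_right_gt.
by near: t; exact: nbhs_right_lt.
Unshelve. all: by end_near. Qed.

Lemma cvg_dist_harmonic (u : nat -> R) (l K : R) :
  (forall N, `|u N - l| <= K / (N%:R + 2^-1)) -> u @ \oo --> l.
Proof.
move=> uK; apply/cvgrPdist_lt => e e0.
near=> N; rewrite distrC (le_lt_trans (uK N))//.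
have N0 : 0 < N%:R + 2^-1 :> R by rewrite ltr_wpDl// invr_gt0.
rewrite ltr_pdivrMr// -ltr_pdivrMl//.
have KN : e^-1 * K < N%:R.
  by near: N; exact: nbhs_infty_gtr.
by rewrite (lt_trans KN)// ltrDl invr_gt0.
Unshelve. all: by end_near. Qed.

(** With [F t = (t - pi) ^+ m.*2.+2 - pi ^+ m.*2.+2], the integral of [F] times [1/2 + \sum cos]
    over [0, pi] tends to 0, so the cosine integrals sum to [- 1/2 \int F], which is the stated
    value. The constant part of [F] does not contribute to them, as [cos (n t)] integrates to 0. *)
Lemma cvg_sum_cos_moment m :
  (fun N => \sum_(0 <= i < N) cos_moment i.+1%:R m.+1) @ \oo -->
  (m.+1%:R / m.*2.+3%:R * pi ^+ m.*2.+3 : R).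
Proof.
have [p pE] := even_power_quotient pi m.+1.
have [K K0 KP] := oscillatory_bound p.
apply: (@cvg_dist_harmonic _ _ K) => N.
pose b : R := pi ^+ m.*2.+2.
(* An antiderivative of [F] times the kernel [1/2 + \sum cos]. *)
pose U (t : R) := ((t - pi) ^+ m.*2.+3 / m.*2.+3%:R - b * t) / 2 +
  \sum_(0 <= i < N)
    (cos_primitive pi i.+1%:R m.+1 t - b * cos_primitive pi i.+1%:R 0 t).
have i0 i : i.+1%:R != 0 :> R by rewrite pnatr_eq0.
have dU t : is_derive t 1 U (t * p.[t] *
    (2^-1 + \sum_(0 <= i < N) cos (i.+1%:R * t))).
  have dsum : has_derive (fun t => \sum_(0 <= i < N)
      (cos_primitive pi i.+1%:R m.+1 t - b * cos_primitive pi i.+1%:R 0 t)) t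
      (\sum_(0 <= i < N) (t * p.[t] * cos (i.+1%:R * t))).
    apply: has_derive_sum => i.
    have ? := is_derive_cos_primitive pi m.+1 t (i0 i).
    have ? := is_derive_cos_primitive pi 0 t (i0 i).
    by derive_as; rewrite pE expr0 /b doubleS; ring.
  rewrite /U; apply: has_derive_is_derive.
    by apply: has_deriveD; [differentiate|exact: dsum].
  rewrite -mulr_sumr pE /b doubleS /=; field.
  by rewrite -natr1 gt_eqF// ltr_wpDl.
have UE : U pi - U 0 =
    \sum_(0 <= i < N) cos_moment i.+1%:R m.+1
      - m.+1%:R / m.*2.+3%:R * pi ^+ m.*2.+3.
  have subDD (x y z w : R) : (x + y) - (z + w) = (y - w) + (x - z) by ring.
  rewrite /U subDD -sumrB; congr (_ + _).
    apply: eq_bigr => i _.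
    rewrite -cos_primitive_moment [cos_primitive _ _ 0 _]/= sin_nat_pi.
    by rewrite [cos_primitive _ _ 0 _]/= mulr0 sin0; ring.
  rewrite subrr sub0r expr0n /= exprS -[_.*2.+2]/(m.+1.*2) -mul2n.
  rewrite (exprM (- pi)) sqrrN -exprM mul2n doubleS /b.
  rewrite (_ : m.*2.+3%:R = 2 * m%:R + 3 :> R); last first.
    by rewrite -mul2n !mulrS mulr0n natrM; ring.
  rewrite (_ : m.+1%:R = m%:R + 1 :> R) -?natr1// !exprS; field.
  by rewrite gt_eqF// ltr_wpDl// mulr_ge0.
rewrite -UE; apply: (@ler_dist_right_cvg U pi).
- exact: pi_gt0.
- by apply: cvg_at_right_filter; exact: is_derive_continuous (dU 0).
move=> t /andP[t0 tpi]; apply: (KP (N%:R + 2^-1) (- (pi / 2)) t pi) => //.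
- by apply: within_itv_continuous => x _; exact: is_derive_continuous (dU x).
move=> x xtpi; apply: has_derive_is_derive (dU x) _.
rewrite cosBpihalf -sum_cos_dirichlet; field.
by rewrite gt_eqF// sin_half_gt0//; lra.
Qed.

End Moments.

(** * Integrals with a singularity at the left endpoint *)

Section ImproperIntegral.
Context {R : realType}.
Notation mu := (@lebesgue_measure R).

(** Monotone convergence along the increasing intervals [[e n, a]], whose union []0, a]] differs
    from [[0, a]] by a null set. *)
Lemma cvg_Rintegral_itv_left (f : R -> R) (a B : R) (e : nat -> R) :
  (forall n, 0 < e n) -> nonincreasing_seq e -> e @ \oo --> 0 ->
  (forall t, 0 < t <= a -> {for t, continuous f}) ->
  (forall t, 0 < t <= a -> 0 <= f t) ->
  (forall n, \int[mu]_(t in `[e n, a]) f t <= B) ->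
  (fun n => \int[mu]_(t in `[e n, a]) f t) @ \oo -->
    \int[mu]_(t in `[0, a]) f t.
Proof.
move=> e0 ndece ecvg cf f0 intB.
have cfn n : {within `[e n, a], continuous f}.
  apply: within_itv_continuous => t /andP[et ta].
  by apply: cf; rewrite ta (lt_le_trans (e0 n)).
have ifn n : mu.-integrable `[e n, a] (EFin \o f).
  by apply: continuous_compact_integrable => //; exact: segment_compact.
have fn0 n t : `[e n, a]%classic t -> (0 <= (f t)%:E)%E.
  rewrite /= in_itv/= => /andP[et ta]; rewrite lee_fin f0// ta andbT.
  exact: lt_le_trans et.
have mfn n := measurable_int _ (ifn n).
have ndF : nondecreasing_seq (fun n => `[e n, a]%classic : set R).
  move=> n p np; rewrite subsetEset; apply: subset_itvr.
  by rewrite bnd_simp; exact: ndece.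
have bigE : \bigcup_n `[e n, a]%classic = `]0, a]%classic :> set R.
  apply/seteqP; split => [t [n _]|t]/=; rewrite !in_itv/= => /andP[t0 ta].
    by rewrite ta (lt_le_trans (e0 n)).
  have [n _ /(_ n (leqnn n)) ent] : \forall n \near \oo, e n < t.
    exact: cvgr_lt ecvg _ t0.
  by exists n => //=; rewrite in_itv/= ta ltW.
have mf0 := (measurable_fun_bigcup _ (fun n => measurable_itv `[e n, a])).2 mfn.
rewrite bigE in mf0.
have := @ge0_nondecreasing_set_cvg_integral _ _ R _ _ mu ndF
  (fun n => measurable_itv _) mfn fn0.
rewrite bigE integral_itv_obnd_cbnd//.
set l := (X in _ --> X); move=> cl.
have fin n : (\int[mu]_(t in `[e n, a]) (f t)%:E =
    (\int[mu]_(t in `[e n, a]) f t)%R%:E)%E.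
  by rewrite /Rintegral fineK//; exact: integrable_fin_num.
(* [Rintegral] is [fine] of an extended real integral, so the limit passes to it only once [B] has
   excluded an infinite value. *)
have lfin : l \is a fin_num.
  rewrite ge0_fin_numE; last first.
    apply: (cvge_to_ge cl); near=> n.
    by apply: integral_ge0 => t tn; exact: (fn0 n).
  rewrite (le_lt_trans _ (ltry B))//; apply: (cvge_to_le cl).
  by near=> n; rewrite /= fin lee_fin.
by move: cl; rewrite -(fineK lfin) => /fine_cvg.
Unshelve. all: by end_near. Qed.

End ImproperIntegral.

(** * The log-sine function near 0 and at pi / 3 *)

Section LogSine.
Context {R : realType}.
Implicit Types t : R.

(** Expanding [cos (3 x) = 0] at [x = pi / 6] and cancelling [cos x > 0] gives
    [cos x ^ 2 = 3 / 4]. *)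
Lemma sin_pi_6 : sin (pi / 6) = 2^-1 :> R.
Proof.
have pi0 := @pi_gt0 R; set x : R := pi / 6.
have c0 : 0 < cos x by apply: cos_gt0_pihalf; rewrite /x; lra.
have s0 : 0 < sin x by apply: sin_gt0_pihalf; rewrite /x; lra.
have : cos (x *+ 2 + x) = 0.
  by rewrite (_ : x *+ 2 + x = pi / 2) ?cos_pihalf// /x; field.
rewrite cosD cos_mulr2n sin_mulr2n => h.
have cs := @cos2Dsin2 R x.
have c2 : cos x ^+ 2 = 3 / 4.
  apply: (mulfI (lt0r_neq0 c0)); nra.
nra.
Qed.

Lemma cos_pi_3 : cos (pi / 3) = 2^-1 :> R.
Proof.
have -> : pi / 3 = (pi / 6) *+ 2 :> R by field.
have := @cos2Dsin2 R (pi / 6).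
by rewrite cos_mulr2n sin_pi_6 => h; lra.
Qed.

Lemma Afun_pi_3 : Afun (pi / 3) = 0 :> R.
Proof.
rewrite /Afun (_ : pi / 3 / 2 = pi / 6); last by field.
by rewrite sin_pi_6 divff// normr1 ln1.
Qed.

Lemma is_derive_Afun t : 0 < t <= pi ->
  is_derive t 1 (@Afun R) (cos (t / 2) / (2 * sin (t / 2))).
Proof.
move=> tpi; have s0 := sin_half_gt0 tpi.
have dln : is_derive t 1 (fun x : R => ln (2 * sin (x / 2)))
    (cos (t / 2) / (2 * sin (t / 2))).
  by derive_as; [lra|field; rewrite gt_eqF].
apply: near_eq_is_derive dln.
have cs : {for t, continuous (fun x : R => 2 * sin (x / 2))}.
  apply: (@is_derive_continuous _ _ _ (cos (t / 2))).
  by derive_as; field.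
near=> x; rewrite /Afun gtr0_norm//.
by near: x; apply: cvgr_gt cs _ _; rewrite mulr_gt0.
Unshelve. all: by end_near. Qed.

Lemma Afun_le0 t : 0 < t <= pi / 3 -> Afun t <= 0.
Proof.
move=> t3; have pi0 := @pi_gt0 R.
have s0 : 0 < sin (t / 2) by apply: sin_half_gt0; lra.
rewrite /Afun ln_le0// gtr0_norm ?mulr_gt0//.
have : sin (t / 2) <= sin (pi / 6).
  by rewrite leNgt ltr_sin ?in_itv/= -?leNgt; lra.
by rewrite sin_pi_6; lra.
Qed.

Lemma Afun_ge t : 0 < t <= pi -> ln (t / 4) <= Afun t.
Proof.
move=> tpi; have s0 := sin_half_gt0 tpi.
have := @sin_ge_quarter R (t / 2) ltac:(lra) => sq.
by rewrite /Afun gtr0_norm ?mulr_gt0// ler_ln ?posrE; lra.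
Qed.

(** Cut-off points tending to 0. The square lets the crude bound [ln x < x] show that [e * Afun e]
    is [O(1 / n)], and the shift by 2 keeps the points at most 1/4, below [pi / 3]. *)
Definition inv_sqr (n : nat) : R := n.+2%:R ^- 2.

Lemma inv_sqr_gt0 n : 0 < inv_sqr n.
Proof. by rewrite /inv_sqr invr_gt0 exprn_gt0. Qed.

Lemma inv_sqr_le n : inv_sqr n <= 4^-1.
Proof.
rewrite /inv_sqr lef_pV2 ?posrE ?exprn_gt0//.
by rewrite -natrX ler_nat (@leq_exp2r 2 n.+2 2).
Qed.

Lemma nonincreasing_inv_sqr : nonincreasing_seq inv_sqr.
Proof.
move=> n p np; rewrite /inv_sqr lef_pV2 ?posrE ?exprn_gt0//.
by rewrite lerXn2r ?nnegrE// ler_nat !ltnS.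
Qed.

Lemma cvg_inv_sqr : inv_sqr @ \oo --> 0.
Proof.
apply: (@squeeze_cvgr _ _ _ _ (cst 0) (@harmonic R)).
- near=> n; rewrite /= ltW ?inv_sqr_gt0//= /inv_sqr lef_pV2 ?posrE ?exprn_gt0//.
  rewrite -natrX ler_nat expnS (@leq_trans n.+2)// expn1 leq_pmulr//.
- exact: cvg_cst.
- exact: cvg_harmonic.
Unshelve. all: by end_near. Qed.

(** Here [- Afun e <= - ln (e / 4) = 2 ln (2 (n + 2)) <= 4 (n + 2)], and [e = (n + 2) ^- 2]. *)
Lemma inv_sqr_Afun_bound n : `|inv_sqr n * Afun (inv_sqr n)| <= 4 * harmonic n.
Proof.
have pi2 := @pi_ge2 R; have e0 := inv_sqr_gt0 n; have e4 := inv_sqr_le n.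
rewrite normrM (gtr0_norm e0) ler0_norm ?Afun_le0//; last by lra.
have n0 : 0 < n.+2%:R :> R by [].
have lnE : ln (inv_sqr n / 4) = - (ln (2 * n.+2%:R) *+ 2) :> R.
  rewrite -lnXn ?mulr_gt0// -lnV ?posrE ?exprn_gt0 ?mulr_gt0//.
  by congr ln; rewrite /inv_sqr; field; rewrite gt_eqF.
have := @Afun_ge (inv_sqr n) ltac:(lra); rewrite lnE => Age.
have := @ln_sublinear R (2 * n.+2%:R) ltac:(by rewrite mulr_gt0) => lnlt.
have Ab : - Afun (inv_sqr n) <= 4 * n.+2%:R by rewrite mulr2n in Age; lra.
apply: (le_trans (ler_wpM2l (ltW e0) Ab)).
rewrite /inv_sqr mulrCA ler_wpM2l// [leLHS](_ : _ = n.+2%:R^-1); last first.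
  by field; rewrite gt_eqF.
by rewrite /= lef_pV2 ?posrE// ler_nat.
Qed.

End LogSine.

(** * The log-sine integral as a sum of sine moments *)

Section LogSineIntegral.
Context {R : realType}.
Notation mu := (@lebesgue_measure R).
Notation a := (pi / 3 : R).
Implicit Types (t e : R) (m N : nat).

(** Each summand is the integral over [0, a] of [F t * sin (i.+1%:R * t)], where
    [F t = (t - a) ^+ m.*2.+2 - a ^+ m.*2.+2]. The estimate is first proved on [[e, a]] by parts
    with [G = F * Afun], then [e] tends to 0. *)
Lemma log_sine_integral_bound m : exists2 K : R, 0 <= K & forall N,
  `| m.*2.+2%:R * SLs R [:: m.*2.+3] +
     \sum_(0 <= i < N) (a ^+ m.*2.+2 * (cos (i.+1%:R * a) / i.+1%:R) -
       m.*2.+2%:R * m.*2.+1%:R *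
         (sin_moment a i.+1%:R m / i.+1%:R ^+ 2)) | <= K / (N%:R + 2^-1).
Proof.
have pi2 := @pi_ge2 R.
have [p pE] := even_power_quotient a m.+1.
have [K K0 KP] := oscillatory_bound p.
exists K => // N.
pose b : R := a ^+ m.*2.+2.
have i0 i : i.+1%:R != 0 :> R by rewrite pnatr_eq0.
(* The factor 1 is [SLs_aux [::]], so that the integral of [f] over [0, a] is the [SLs] value by
   conversion. *)
pose f (t : R) : R := SLs_integrand m.*2.+3 t * 1.
have fE (t : R) : f t = (t - a) ^+ m.*2.+1 * Afun t.
  by rewrite /f /SLs_integrand mulr1 !subSS subn0.
have cf (t : R) : 0 < t <= a -> {for t, continuous f}.
  move=> ta; have dA := @is_derive_Afun R t ltac:(lra).
  rewrite (_ : f = fun t => (t - a) ^+ m.*2.+1 * Afun t); last exact/funext.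
  by apply: is_derive_continuous; derive_as.
have f0 (t : R) : 0 < t <= a -> 0 <= f t.
  move=> ta; rewrite fE; apply: mulr_le0; last exact: Afun_le0.
  rewrite exprS -mul2n exprM; apply: mulr_le0_ge0; first by lra.
  by rewrite exprn_ge0// sqr_ge0.
pose P i (t : R) : R := sin_primitive a i.+1%:R m.+1 t - b * sin_primitive a i.+1%:R 0 t.
pose S (t : R) : R := \sum_(0 <= i < N) P i t.
have dS (t : R) : is_derive t 1 S
    (t * p.[t] * \sum_(0 <= i < N) sin (i.+1%:R * t)).
  rewrite mulr_sumr; apply: has_derive_sum => i.
  have ? := is_derive_sin_primitive a m.+1 t (i0 i).
  have ? := is_derive_sin_primitive a 0 t (i0 i).
  by rewrite /P; derive_as; rewrite pE expr0 /b doubleS; ring.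
pose G (t : R) : R := ((t - a) ^+ m.*2.+2 - b) * Afun t.
have partial (e : R) : 0 < e < a ->
    `|m.*2.+2%:R * (\int[mu]_(t in `[e, a]) f t) + (S a - S e) + G e| <=
    K / (N%:R + 2^-1).
  move=> /andP[e0 ea].
  pose I (t : R) : R := \int[mu]_(x in `[e, t]) f x.
  have cfe : {within `[e, a], continuous f}.
    by apply: within_itv_continuous => t eta; apply: cf; lra.
  have intf : mu.-integrable `[e, a] (EFin \o f).
    by apply: continuous_compact_integrable => //; exact: segment_compact.
  have dI (t : R) : e < t < a -> is_derive t 1 I (f t).
    move=> /andP[et ta].
    have [] := continuous_FTC1_closed ta intf et (cf t ltac:(lra)).
    by move=> dI IE; split => //; rewrite -derive1E.
  have cI : {within `[e, a], continuous I}.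
    exact: parameterized_integral_continuous (ltW ea) intf.
  have dG (t : R) : 0 < t <= a -> is_derive t 1 G
      (m.*2.+2%:R * f t + t * p.[t] * (cos (t / 2) / (2 * sin (t / 2)))).
    move=> ta; have ? := @is_derive_Afun R t ltac:(lra).
    by rewrite /G; derive_as; rewrite fE pE doubleS /b /=; ring.
  (* Its derivative is [F t] times [cot (t / 2) / 2 - \sum sin (n t)], which [sum_sin_dirichlet]
     turns into [F t * cos ((N + 1/2) t) / (2 sin (t / 2))]. *)
  pose U (t : R) : R := G t - m.*2.+2%:R * I t - S t.
  have cU : {within `[e, a], continuous U}.
    move=> t; apply: cvgB; first apply: cvgB.
    - apply: (within_itv_continuous (f := G)) => {}t tea.
      by apply: is_derive_continuous (dG t _); lra.
    - by apply: cvgM; [exact: cvg_cst|exact: cI].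
    - apply: (within_itv_continuous (f := S)) => {}t tea.
      exact: is_derive_continuous (dS t).
  have dU (t : R) : e < t < a -> is_derive t 1 U
      (t * p.[t] / (2 * sin (t / 2)) * cos ((N%:R + 2^-1) * t + 0)).
    move=> eta; have ? := dI t eta; have ? := dS t.
    have ? := dG t ltac:(lra).
    have s0 : 0 < sin (t / 2) by apply: sin_half_gt0; lra.
    rewrite /U; derive_as.
    have := sum_sin_dirichlet t N; rewrite addr0.
    set D := \sum_(_ <= _ < _) _; move=> DE.
    have -> : cos ((N%:R + 2^-1) * t) = cos (t / 2) - 2 * sin (t / 2) * D.
      by rewrite DE; ring.
    by field; rewrite gt_eqF.
  have := KP (N%:R + 2^-1) 0 e a U ltac:(by rewrite ltr_wpDl// invr_gt0)
    e0 ea ltac:(lra) cU dU.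
  have Ie : I e = 0 by rewrite /I set_itv1 Rintegral_set1.
  rewrite /U Ie {1}/G Afun_pi_3 -normrN; congr (`|_| <= _).
  by rewrite -/(I a); ring.
pose e n := @inv_sqr R n.
have ea n : 0 < e n < a.
  by rewrite inv_sqr_gt0/=; have := @inv_sqr_le R n; rewrite -/(e n); lra.
have cG : G (e n) @[n --> \oo] --> 0.
  have [B B0 BP] := horner_bounded p a.
  apply/norm_cvg0P.
  apply: (@squeeze_cvgr _ _ _ _ (cst 0) (fun n => B * 4 * @harmonic R n)).
  (* The zero of [F] at 0 absorbs the logarithm: [G e = p.[e] * (e * Afun e)]. *)
  - near=> n; rewrite /= normr_ge0/= /G /b -pE (mulrC (e n)).
    rewrite -(mulrA p.[e n]) normrM -(mulrA B); apply: ler_pM => //; last exact: inv_sqr_Afun_bound.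
    by apply: BP; have := ea n; lra.
  - exact: cvg_cst.
  - by rewrite -(mulr0 (B * 4)); apply: cvgMr; exact: cvg_harmonic.
have cS : S (e n) @[n --> \oo] --> S 0.
  have cS0 : {for 0, continuous S} := is_derive_continuous (dS 0).
  exact: (cvg_comp _ _ (@cvg_inv_sqr R) cS0).
have q0 : 0 < m.*2.+2%:R :> R by [].
have cInt : \int[mu]_(t in `[e n, a]) f t @[n --> \oo] --> SLs R [:: m.*2.+3].
  (* The terms of [partial] other than the integral converge, hence are bounded; this bounds the
     integrals over [[e n, a]] uniformly in [n]. *)
  have [B BP] : exists B : R, forall n, `|(S a - S (e n)) + G (e n)| <= B.
    have : cvgn (fun n => (S a - S (e n)) + G (e n)).
      apply/cvg_ex; exists ((S a - S 0) + 0).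
      by apply: cvgD => //; apply: cvgB => //; exact: cvg_cst.
    move=> /cvg_seq_bounded [B [_ BP]].
    by exists (B + 1) => n; apply: BP => //; rewrite ltrDl.
  apply: (@cvg_Rintegral_itv_left _ _ _ (K / (N%:R + 2^-1) + B)) => //.
  - exact: inv_sqr_gt0.
  - exact: nonincreasing_inv_sqr.
  - exact: cvg_inv_sqr.
  move=> n; set x := \int[mu]_(t in _) _.
  have := partial (e n) (ea n); rewrite -/x => px.
  have x0 : 0 <= x.
    apply: Rintegral_ge0 => t; rewrite /= in_itv/= => eta.
    by apply: f0; have := ea n; lra.
  have : `|m.*2.+2%:R * x| <= K / (N%:R + 2^-1) + B.
    have -> : m.*2.+2%:R * x = (m.*2.+2%:R * x + (S a - S (e n)) + G (e n))
        - ((S a - S (e n)) + G (e n)) by ring.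
    by rewrite (le_trans (ler_normB _ _))// lerD.
  rewrite ger0_norm ?mulr_ge0//; apply: le_trans.
  by rewrite ler_peMl// ler1n.
have SE : S a - S 0 = \sum_(0 <= i < N)
    (a ^+ m.*2.+2 * (cos (i.+1%:R * a) / i.+1%:R) -
       m.*2.+2%:R * m.*2.+1%:R * (sin_moment a i.+1%:R m / i.+1%:R ^+ 2)).
  rewrite /S -sumrB; apply: eq_bigr => i _.
  have h1 := sin_primitive_moment a m.+1 (i0 i).
  have h0 := sin_primitive_moment a 0 (i0 i).
  rewrite /P (_ : _ - _ = sin_moment a i.+1%:R m.+1 - b * sin_moment a i.+1%:R 0).
    by rewrite /b [sin_moment _ _ _.+1]/= [sin_moment _ _ 0]/=; field.
  by rewrite -h1 -h0; ring.
rewrite -SE.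
have cL : `|m.*2.+2%:R * (\int[mu]_(t in `[e n, a]) f t) + (S a - S (e n))
    + G (e n)| @[n --> \oo] -->
    `|m.*2.+2%:R * SLs R [:: m.*2.+3] + (S a - S 0) + 0|.
  apply: cvg_norm; apply: cvgD => //; apply: cvgD.
    by apply: cvgMr.
  by apply: cvgB => //; exact: cvg_cst.
rewrite addr0 in cL; apply: (cvgr_to_le cL).
by near=> n; exact: partial.
Unshelve. all: by end_near. Qed.

End LogSineIntegral.

(** * Cosine series at pi / 3 and moment series in terms of zeta values *)

Section ZetaSums.
Context {R : realType}.
Notation a := (pi / 3 : R).
Implicit Types (m r s N L : nat).

Notation zeta_sum s := (series (fun n : nat => (((n.+1)%:R : R) ^+ s)^-1)).

(** The partial sums increase and are bounded by telescoping
    [1 / n ^ 2 <= 2 (1 / n - 1 / (n + 1))]. *)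
Lemma cvg_zeta s : (2 <= s)%N -> zeta_sum s @ \oo --> zeta R s.
Proof.
move=> s2.
have b2 N : zeta_sum s N <= 2 * (1 - N.+1%:R^-1).
  elim: N => [|N IHN]; first by rewrite seriesEnat/= big_nil invr1 subrr mulr0.
  rewrite seriesEnat/= big_nat_recr//=.
  have N0 : 0 < N.+1%:R :> R by [].
  have NN : N.+2%:R = N.+1%:R + 1 :> R by rewrite -natr1.
  have : (N.+1%:R ^+ s)^-1 <= (N.+1%:R ^+ 2)^-1 :> R.
    by rewrite lef_pV2 ?posrE ?exprn_gt0// ler_weXn2l// ler1n.
  have : (N.+1%:R ^+ 2)^-1 <= 2 * (N.+1%:R^-1 - N.+2%:R^-1) :> R.
    rewrite NN -subr_ge0 (_ : _ - _ =
      (N.+1%:R - 1) / (N.+1%:R ^+ 2 * (N.+1%:R + 1)) :> R).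
      by rewrite divr_ge0 ?subr_ge0 ?ler1n// mulr_ge0 ?exprn_ge0// addr_ge0.
    by field; rewrite !gt_eqF// addr_gt0.
  rewrite seriesEnat/= in IHN => h2 h1.
  apply: (le_trans (lerD IHN (le_trans h1 h2))).
  by move: N.+1%:R^-1 N.+2%:R^-1 => x y; lra.
apply: nondecreasing_is_cvgn.
  apply/nondecreasing_seqP => N; rewrite !seriesEnat/= big_nat_recr//= lerDl.
  by rewrite invr_ge0 exprn_ge0.
exists 2 => _ [N _ <-]; apply: (le_trans (b2 N)).
have : 0 < N.+1%:R^-1 :> R by rewrite invr_gt0.
by move: N.+1%:R^-1 => x; lra.
Qed.

Lemma cvg_muln_index (u : nat -> R) (l : R) k : (0 < k)%N ->
  u @ \oo --> l -> (fun n => u (k * n)%N) @ \oo --> l.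
Proof.
by move=> k0; exact: (cvg_comp _ _ (cvg_mulnl k k0)).
Qed.

Lemma cos_pi_3_period L j :
  cos ((6 * L + j)%:R * a) = cos (j%:R * a).
Proof.
have -> : (6 * L + j)%:R * a = j%:R * a + pi *+ 2 *+ L.
  by rewrite natrD natrM -[pi *+ 2 *+ L]mulr_natr; field.
exact: (periodicn (@cosD2pi R)).
Qed.

(* As a function of [n], [2 cos (n pi / 3)] is
   [1 - 2 [2 | n] - 3 [3 | n] + 6 [6 | n]]. *)
Lemma sum_cos_pi_3 (h : nat -> R) L :
  \sum_(0 <= i < 6 * L) cos (i.+1%:R * a) * h i.+1 =
  2^-1 * (\sum_(0 <= i < 6 * L) h i.+1
          - 2 * \sum_(0 <= i < 3 * L) h (2 * i.+1)%N
          - 3 * \sum_(0 <= i < 2 * L) h (3 * i.+1)%N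
          + 6 * \sum_(0 <= i < L) h (6 * i.+1)%N).
Proof.
elim: L => [|L IHL]; first by rewrite !muln0 !big_nil; ring.
have c1 : cos (1%:R * a) = 2^-1 by rewrite mul1r cos_pi_3.
have c2 : cos (2%:R * a) = - 2^-1.
  by rewrite mulr_natl cos_mulr2n cos_pi_3; field.
have c3 : cos (3%:R * a) = - 1.
  by rewrite (_ : 3%:R * a = pi) ?cospi//; field.
have c4 : cos (4%:R * a) = - 2^-1.
  by rewrite (_ : 4%:R * a = a + pi) ?cosDpi ?cos_pi_3//; field.
have c5 : cos (5%:R * a) = 2^-1.
  by rewrite (_ : 5%:R * a = 2%:R * a + pi) ?cosDpi ?c2 ?opprK//; field.
have c6 : cos (6%:R * a) = 1.
  by rewrite (_ : 6%:R * a = pi *+ 2) ?cos2pi//; field.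
have -> : (6 * L.+1 = (6 * L).+4.+2)%N by lia.
have -> : (3 * L.+1 = (3 * L).+3)%N by lia.
have -> : (2 * L.+1 = (2 * L).+2)%N by lia.
rewrite !big_nat_recr//= IHL.
have -> : (2 * (3 * L).+1 = (6 * L).+2)%N by lia.
have -> : (2 * (3 * L).+2 = (6 * L).+4)%N by lia.
have -> : (2 * (3 * L).+3 = (6 * L).+4.+2)%N by lia.
have -> : (3 * (2 * L).+1 = (6 * L).+3)%N by lia.
have -> : (3 * (2 * L).+2 = (6 * L).+4.+2)%N by lia.
have -> : (6 * L.+1 = (6 * L).+4.+2)%N by lia.
have := (cos_pi_3_period L 1, cos_pi_3_period L 2, cos_pi_3_period L 3,
  cos_pi_3_period L 4, cos_pi_3_period L 5, cos_pi_3_period L 6).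
rewrite c1 c2 c3 c4 c5 c6 !addnS !addn0 => -[[[[[-> ->] ->] ->] ->] ->].
by field.
Qed.

Lemma sum_cos_pi_3_zeta s L :
  \sum_(0 <= i < 6 * L) cos (i.+1%:R * a) / i.+1%:R ^+ s =
  2^-1 * (zeta_sum s (6 * L)%N - 2 / 2 ^+ s * zeta_sum s (3 * L)%N
          - 3 / 3 ^+ s * zeta_sum s (2 * L)%N + 6 / 6 ^+ s * zeta_sum s L).
Proof.
rewrite (sum_cos_pi_3 (fun n => (n%:R ^+ s)^-1)) !seriesEnat/=.
have dil k M : \sum_(0 <= i < M) ((k * i.+1)%:R ^+ s)^-1 =
    (k%:R ^+ s)^-1 * \sum_(0 <= i < M) (i.+1%:R ^+ s)^-1 :> R.
  by rewrite mulr_sumr; apply: eq_bigr => i _; rewrite natrM exprMn invfM.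
by rewrite (dil 2) (dil 3) (dil 6); ring.
Qed.

Lemma cvg_sum_cos_pi_3 s : (2 <= s)%N ->
  (fun L => \sum_(0 <= i < 6 * L) cos (i.+1%:R * a) / i.+1%:R ^+ s) @ \oo -->
  2^-1 * (1 - 2 / 2 ^+ s - 3 / 3 ^+ s + 6 / 6 ^+ s) * zeta R s.
Proof.
move=> s2; under eq_fun do rewrite sum_cos_pi_3_zeta.
have zc k : (0 < k)%N -> (fun L => zeta_sum s (k * L)%N) @ \oo --> zeta R s.
  by move=> k0; exact: cvg_muln_index (cvg_zeta s2).
rewrite (_ : 2^-1 * _ * _ = 2^-1 * (zeta R s - 2 / 2 ^+ s * zeta R s
  - 3 / 3 ^+ s * zeta R s + 6 / 6 ^+ s * zeta R s)); last by ring.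
apply: cvgMr; apply: cvgD; last by apply: cvgMr; exact: cvg_zeta.
by apply: cvgB; [apply: cvgB; [|apply: cvgMr]|apply: cvgMr]; exact: zc.
Qed.

(** For [s = 1] the four harmonic sums diverge separately, but with [H] for [zeta_sum 1] they group
    as [1/2 (u (3 L) - u L)], where [u L = H (2 L) - H L] converges. *)
Lemma cvg_sum_cos_pi_3_1 :
  (fun L => \sum_(0 <= i < 6 * L) cos (i.+1%:R * a) / i.+1%:R) @ \oo --> 0.
Proof.
pose u L : R := zeta_sum 1 (2 * L)%N - zeta_sum 1 L.
have uS L : u L.+1 = u L + ((2 * L).+1%:R^-1 - (2 * L).+2%:R^-1).
  rewrite /u !seriesEnat/= (_ : (2 * L.+1 = (2 * L).+2)%N); last by lia.
  rewrite !big_nat_recr//= !expr1.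
  rewrite (_ : L.+1%:R^-1 = 2 * (2 * L).+2%:R^-1 :> R); first by ring.
  rewrite (_ : (2 * L).+2 = 2 * L.+1)%N; last by lia.
  by rewrite natrM invfM mulrA divff// mul1r.
have ucvg : cvgn u.
  apply: nondecreasing_is_cvgn.
    apply/nondecreasing_seqP => L; rewrite uS lerDl subr_ge0.
    by rewrite lef_pV2 ?posrE// ler_nat.
  exists 1 => _ [L _ <-].
  suff : u L <= 1 - (2 * L).+1%:R^-1.
    move=> /le_trans; apply; by rewrite gerBl invr_ge0.
  (* The increment [1 / (2 L + 1) - 1 / (2 L + 2)] is at most [1 / (2 L + 1) - 1 / (2 L + 3)], which
     telescopes. *)
  elim: L => [|L IHL]; first by rewrite /u muln0 subrr invr1 subrr.
  rewrite uS (_ : (2 * L.+1 = (2 * L).+2)%N); last by lia.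
  apply: (le_trans (lerD IHL (lexx _))).
  have : (2 * L).+3%:R^-1 <= (2 * L).+2%:R^-1 :> R.
    by rewrite lef_pV2 ?posrE// ler_nat.
  by move: (2 * L).+1%:R^-1 (2 * L).+2%:R^-1 (2 * L).+3%:R^-1 => x y z; lra.
have l0 : 2^-1 * (limn u - limn u) = 0 :> R by rewrite subrr mulr0.
rewrite -[X in _ --> X]l0 (_ : (fun _ => _) = (fun L => 2^-1 * (u (3 * L)%N - u L))).
  by apply: cvgMr; apply: cvgB => //; exact: cvg_muln_index.
apply/funext => L; have := sum_cos_pi_3_zeta 1 L.
rewrite !expr1 !divff// !mul1r.
under eq_bigr do rewrite expr1.
by move=> ->; rewrite /u mulnA; ring.
Qed.

(* The limit of [\sum_(n > 0) sin_moment a n m / n ^+ r]. *)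
Fixpoint sin_moment_series m r : R :=
  if m is m'.+1 then
    a ^+ m'.*2.+2 * zeta R r.+1 -
    m'.*2.+2%:R * m'.*2.+1%:R * sin_moment_series m' r.+2
  else 2^-1 * (1 + 2 / 2 ^+ r.+1 + 3 / 3 ^+ r.+1 - 6 / 6 ^+ r.+1) * zeta R r.+1.

(* The limit of [\sum_(n > 0) cos_moment n m / n ^+ r]. *)
Fixpoint cos_moment_series m r : R :=
  if m is m'.+1 then
    m'.*2.+2%:R * pi ^+ m'.*2.+1 * zeta R r.+2 -
    m'.*2.+2%:R * m'.*2.+1%:R * cos_moment_series m' r.+2
  else 0.

Lemma cos_moment_seriesS m r : cos_moment_series m.+1 r =
  m.*2.+2%:R * pi ^+ m.*2.+1 * zeta R r.+2 -
  m.*2.+2%:R * m.*2.+1%:R * cos_moment_series m r.+2.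
Proof. by []. Qed.

(** Only multiples of 6 are taken as upper limits, since [sum_cos_pi_3] evaluates the cosine sums
    over whole periods. *)
Lemma cvg_sin_moment_series m r : (0 < r)%N ->
  (fun L => \sum_(0 <= i < 6 * L) sin_moment a i.+1%:R m / i.+1%:R ^+ r) @ \oo
  --> sin_moment_series m r.
Proof.
have i0 i : i.+1%:R != 0 :> R by rewrite pnatr_eq0.
have z6 s : (2 <= s)%N -> (fun L => zeta_sum s (6 * L)%N) @ \oo --> zeta R s.
  by move=> s2; exact: cvg_muln_index (cvg_zeta s2).
elim: m r => [|m IHm] r r0 /=.
  (* Since [sin_moment a n 0 = (1 - cos (n a)) / n], the base case is [zeta] minus the cosine series
     of exponent [r.+1]. *)
  rewrite (_ : 2^-1 * _ * _ = zeta R r.+1 -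
    2^-1 * (1 - 2 / 2 ^+ r.+1 - 3 / 3 ^+ r.+1 + 6 / 6 ^+ r.+1) * zeta R r.+1).
    rewrite (_ : (fun _ => _) = (fun L => zeta_sum r.+1 (6 * L)%N -
      \sum_(0 <= i < 6 * L) cos (i.+1%:R * a) / i.+1%:R ^+ r.+1)).
      by apply: cvgB; [exact: z6|exact: cvg_sum_cos_pi_3].
    apply/funext => L; rewrite seriesEnat/= -sumrB; apply: eq_bigr => i _.
    by move: (i0 i); move: i.+1%:R => c c0; rewrite exprS; field;
      rewrite ?c0 ?expf_neq0.
  by field; rewrite !expf_neq0.
rewrite (_ : (fun _ => _) = (fun L => a ^+ m.*2.+2 * zeta_sum r.+1 (6 * L)%N -
  m.*2.+2%:R * m.*2.+1%:R *
  \sum_(0 <= i < 6 * L) sin_moment a i.+1%:R m / i.+1%:R ^+ r.+2)).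
  by apply: cvgB; apply: cvgMr; [exact: z6|exact: IHm].
apply/funext => L; rewrite seriesEnat/= !mulr_sumr -sumrB; apply: eq_bigr => i _.
by move: (i0 i); move: i.+1%:R => c c0; rewrite !exprS; field;
  rewrite ?c0 ?expf_neq0.
Qed.

Lemma cvg_cos_moment_series m r :
  (fun N => \sum_(0 <= i < N) cos_moment (i.+1%:R : R) m / i.+1%:R ^+ r) @ \oo
  --> cos_moment_series m r.
Proof.
have i0 i : i.+1%:R != 0 :> R by rewrite pnatr_eq0.
elim: m r => [|m IHm] r /=.
  rewrite (_ : (fun _ => _) = cst 0); first exact: cvg_cst.
  by apply/funext => N; rewrite big1// => i _; rewrite mul0r.
rewrite (_ : (fun _ => _) = (fun N =>
  m.*2.+2%:R * pi ^+ m.*2.+1 * zeta_sum r.+2 N - m.*2.+2%:R * m.*2.+1%:R *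
  \sum_(0 <= i < N) cos_moment (i.+1%:R : R) m / i.+1%:R ^+ r.+2)).
  by apply: cvgB; apply: cvgMr; [exact: cvg_zeta|exact: IHm].
apply/funext => N; rewrite seriesEnat/= !mulr_sumr -sumrB; apply: eq_bigr => i _.
by move: (i0 i); move: i.+1%:R => c c0; rewrite !exprS; field;
  rewrite ?c0 ?expf_neq0.
Qed.

(** The bound of [log_sine_integral_bound] makes the whole sequence converge to the [SLs] side, and
    the subsequence of multiples of 6 identifies the limit. The terms [cos (n a) / n] sum to 0. *)
Lemma SLs_moment_series m :
  SLs R [:: m.*2.+3] = m.*2.+1%:R * sin_moment_series m 2.
Proof.
have [K K0 KP] := @log_sine_integral_bound R m.
have q0 : m.*2.+2%:R != 0 :> R by rewrite pnatr_eq0.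
pose u N := - \sum_(0 <= i < N) (a ^+ m.*2.+2 * (cos (i.+1%:R * a) / i.+1%:R) -
       m.*2.+2%:R * m.*2.+1%:R * (sin_moment a i.+1%:R m / i.+1%:R ^+ 2)).
have ucvg : u @ \oo --> m.*2.+2%:R * SLs R [:: m.*2.+3].
  apply: (@cvg_dist_harmonic _ _ _ K) => N.
  by rewrite -normrN opprB /u opprK.
have u6cvg : (fun L => u (6 * L)%N) @ \oo -->
    m.*2.+2%:R * (m.*2.+1%:R * sin_moment_series m 2); last first.
  apply: (mulfI q0).
  exact: (cvg_unique (@Rhausdorff R) (cvg_muln_index (isT : 0 < 6)%N ucvg)).
rewrite (_ : (fun _ => _) = (fun L => m.*2.+2%:R * m.*2.+1%:R *
    \sum_(0 <= i < 6 * L) sin_moment a i.+1%:R m / i.+1%:R ^+ 2 -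
    a ^+ m.*2.+2 * \sum_(0 <= i < 6 * L) cos (i.+1%:R * a) / i.+1%:R)).
  rewrite [X in _ --> X](_ : _ = m.*2.+2%:R * m.*2.+1%:R *
    sin_moment_series m 2 - a ^+ m.*2.+2 * 0); last by ring.
  apply: cvgB; apply: cvgMr; first exact: cvg_sin_moment_series.
  exact: cvg_sum_cos_pi_3_1.
by apply/funext => L; rewrite /u sumrB opprB !mulr_sumr.
Qed.

(** Two evaluations of one limit: a combination of even zeta values equals a rational multiple of a
    power of [pi]. *)
Lemma cos_moment_series_pi m :
  cos_moment_series m.+1 0 = m.+1%:R / m.*2.+3%:R * pi ^+ m.*2.+3.
Proof.
have := @cvg_cos_moment_series m.+1 0.
under eq_fun do under eq_bigr do rewrite expr0 divr1.
move=> /(cvg_unique (@Rhausdorff R)); apply; exact: cvg_sum_cos_moment.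
Qed.

End ZetaSums.

(** * Rational spans and the triangular systems *)

Section RationalSpan.
Context {R : realType}.
Implicit Types (S T : set R) (x y : R) (q : rat) (k m r : nat).

Lemma in_Qspan_mem S x : S x -> in_Qspan S x.
Proof.
move=> Sx; exists [:: (1, x)]; split => [p|]; first by rewrite inE => /eqP->.
by rewrite big_seq1 rmorph1 mul1r.
Qed.

Lemma in_QspanD S x y : in_Qspan S x -> in_Qspan S y -> in_Qspan S (x + y).
Proof.
move=> [l [lS ->]] [l' [l'S ->]]; exists (l ++ l'); split; last by rewrite big_cat.
by move=> p; rewrite mem_cat => /orP[/lS|/l'S].
Qed.

Lemma in_QspanZ_image S T c q x : (forall y, S y -> T (c * y)) ->
  in_Qspan S x -> in_Qspan T (ratr q * c * x).
Proof.
move=> ST [l [lS ->]]; exists [seq (q * p.1, c * p.2) | p <- l]; split.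
  by move=> _ /mapP[p pl ->]; apply: ST; exact: lS.
rewrite big_map mulr_sumr; apply: eq_bigr => p _ /=.
by rewrite rmorphM /=; ring.
Qed.

Lemma in_QspanZ S q x : in_Qspan S x -> in_Qspan S (ratr q * x).
Proof.
move=> Sx; rewrite -(mulr1 (ratr q)); apply: in_QspanZ_image Sx => y.
by rewrite mul1r.
Qed.

Lemma in_QspanB S x y : in_Qspan S x -> in_Qspan S y -> in_Qspan S (x - y).
Proof.
move=> Sx Sy; rewrite (_ : - y = ratr (- 1) * y); last by rewrite rmorphN1 mulN1r.
exact: in_QspanD Sx (in_QspanZ _ Sy).
Qed.

Lemma in_QspanZ_inv S q x : q != 0 -> in_Qspan S (ratr q * x) -> in_Qspan S x.
Proof.
move=> q0 /(in_QspanZ q^-1).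
by rewrite mulrA -rmorphM /= mulVf// rmorph1 mul1r.
Qed.

Lemma Sprime_pi k d m x : Sprime k d x -> Sprime (2 * m + k) d (pi ^+ (2 * m) * x).
Proof.
move=> [m' [ks [<- sz al ->]]]; exists (m + m')%N, ks; split=> //.
  by rewrite mulnDr addnA.
by rewrite mulrA -exprD mulnDr.
Qed.

Notation V k := (in_Qspan (@Sprime R k 1)).

(* Each row [W m r] involves the [zeta] values of weight up to [r + s + 2 m],
   the last one with a nonzero rational coefficient. *)
Lemma triangular_zeta_span (s r0 : nat) (W : nat -> nat -> R)
    (c b e : nat -> rat) :
  (forall r, c r != 0) -> (forall m, e m != 0) ->
  (forall r, W 0 r = ratr (c r) * zeta R (r + s)) ->
  (forall m r, W m.+1 r = ratr (b m) * pi ^+ (2 * m.+1) * zeta R (r + s) -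
                          ratr (e m) * W m r.+2) ->
  (forall m, V (2 * m + (r0 + s)) (W m r0)) ->
  forall m, V (2 * m + (r0 + s)) (zeta R (2 * m + (r0 + s))).
Proof.
move=> c0 e0 W0 WS VW.
(* Modulo the span, [W m r] is a nonzero rational multiple of its top zeta value. Here [r] varies
   because the recursion for [W] trades one step in [m] for two in [r], at constant total weight. *)
have row m r : (forall i, (i < m)%N ->
      V (2 * i + (r + s)) (zeta R (2 * i + (r + s)))) ->
    exists2 q, q != 0 &
      V (2 * m + (r + s)) (W m r - ratr q * zeta R (2 * m + (r + s))).
  elim: m r => [|m IHm] r Vz.
    exists (c r) => //; rewrite W0 muln0 add0n subrr.
    by exists [::]; split=> //; rewrite big_nil.
  have weightS i : (2 * i + (r.+2 + s) = 2 * i.+1 + (r + s))%N by lia.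
  have [i im|q q0 Vq] := IHm r.+2; first by rewrite weightS; exact: Vz.
  exists (- e m * q); first by rewrite mulf_neq0// oppr_eq0.
  rewrite weightS in Vq; rewrite WS.
  rewrite [X in V _ X](_ : _ = ratr (b m) * pi ^+ (2 * m.+1) * zeta R (r + s) -
    ratr (e m) * (W m r.+2 - ratr q * zeta R (2 * m.+1 + (r + s)))); last first.
    by rewrite rmorphM rmorphN /=; ring.
  apply: in_QspanB; last exact: in_QspanZ.
  have := Vz 0%N isT; rewrite muln0 add0n; apply: in_QspanZ_image => y.
  exact: Sprime_pi.
elim/ltn_ind => m IHm; have [q q0 Vq] := row m r0 IHm.
apply: (in_QspanZ_inv q0).
rewrite (_ : ratr q * _ = W m r0 - (W m r0 - ratr q * zeta R (2 * m + (r0 + s)))).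
  exact: in_QspanB.
by ring.
Qed.

Lemma zeta_even_span m : V (2 * m + 2) (zeta R (2 * m + 2)).
Proof.
have pi0 : pi != 0 :> R by rewrite gt_eqF// pi_gt0.
(* Dividing by [pi] makes the odd powers of [pi] in the recursion even. The index starts at [m.+1]
   because the moment series of index 0 is zero. *)
apply: (@triangular_zeta_span 2 0 (fun m r => @cos_moment_series R m.+1 r / pi)
  (fun=> 2) (fun m => m.*2.+4%:R) (fun m => m.*2.+4%:R * m.*2.+3%:R)).
- by [].
- by move=> i; rewrite mulf_neq0// pnatr_eq0.
- move=> r /=; rewrite rmorph_nat addn2 double0 expr1.
  by move: (pi : R) pi0 => p p0; field.
- move=> i r; rewrite cos_moment_seriesS rmorphM /= !ratr_nat addn2 mul2n doubleS.
  by move: cos_moment_series (pi : R) pi0 => w p p0; rewrite !exprS; field.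
move=> i; rewrite cos_moment_series_pi add0n.
rewrite (_ : _ / pi = ratr (i.+1%:R / i.*2.+3%:R) * pi ^+ (2 * i + 2)).
  (* A pure power of [pi]: the witness has the empty list of arguments, with [SLs] equal to 1. *)
  apply/in_QspanZ/in_Qspan_mem; exists i.+1, [::]; split => //.
    by rewrite /= mulnS addn0 addnC.
  by rewrite /SLs /= mulr1 mulnS addnC.
rewrite rmorphM fmorphV /= !ratr_nat addn2 mul2n !exprS.
have q0 : i.*2.+3%:R != 0 :> R by rewrite pnatr_eq0.
by move: (i.*2.+3%:R) q0 (pi : R) pi0 => q q0 p p0; field; rewrite q0.
Qed.

Lemma zeta_odd_span m : V (2 * m + 3) (zeta R (2 * m + 3)).
Proof.
apply: (@triangular_zeta_span 1 2 (@sin_moment_series R)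
  (fun r => 2^-1 * (1 + 2 / 2 ^+ r.+1 + 3 / 3 ^+ r.+1 - 6 / 6 ^+ r.+1))
  (fun m => 3 ^- (2 * m.+1)) (fun m => m.*2.+2%:R * m.*2.+1%:R)).
(* The only negative term, [6 / 6 ^+ r.+1], is at most 1, and two strictly positive terms remain. *)
- move=> r; rewrite mulf_neq0// gt_eqF//.
  have le1 : 6 / 6 ^+ r.+1 <= 1 :> rat.
    by rewrite exprS invfM mulrA divff// mul1r invf_le1 ?exprn_gt0// exprn_ege1.
  have gt2 : 0 < 2 / 2 ^+ r.+1 :> rat by rewrite divr_gt0// exprn_gt0.
  have gt3 : 0 < 3 / 3 ^+ r.+1 :> rat by rewrite divr_gt0// exprn_gt0.
  by lra.
- by move=> i; rewrite mulf_neq0// pnatr_eq0.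
- move=> r /=; rewrite addn1; congr (_ * _).
  by rewrite !(rmorphM, rmorphB, rmorphD, fmorphV, rmorphXn, rmorph1, ratr_nat).
- move=> i r; rewrite [in LHS]/= rmorphM /= !ratr_nat addn1.
  rewrite fmorphV rmorphXn /= ratr_nat mul2n doubleS expr_div_n.
  by rewrite (mulrC (pi ^+ _)).
(* The value of the row is [SLs R [:: i.*2.+3]] up to the factor [i.*2.+1], a depth-one
   generator. *)
move=> i; have := @SLs_moment_series R i => SE.
apply: (@in_QspanZ_inv _ i.*2.+1%:R); first by rewrite pnatr_eq0.
rewrite ratr_nat -SE; apply: in_Qspan_mem; exists 0%N, [:: i.*2.+3]; split => //.
- by rewrite /= addn0 muln0 add0n mul2n !addnS addn0.
- by rewrite /= odd_double.
- by rewrite muln0 mul1r.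
Qed.

End RationalSpan.

Theorem theorem4 (R : realType) (k : nat) :
  (2 <= k)%N -> in_Qspan (@Sprime R k 1) (@zeta R k).
Proof.
move=> k2; have := odd_double_half k; case: (odd k) => kE.
- have -> : k = (2 * (k./2 - 1) + 3)%N by lia.
  exact: zeta_odd_span.
- have -> : k = (2 * (k./2 - 1) + 2)%N by lia.
  exact: zeta_even_span.
Qed.
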